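(* Let $(V,g)$ be a Euclidean real vector space of dimension $n$ and let $\omega$ be a symmetric $(p,p)$ double form on $V$ ($p\ge1$) satisfying the first Bianchi identity. For integers $m\ge 1$ and $r\ge0$ put $$h_{(r,pm)}(\omega)=\sum_{j=\max\{0,pm-r\}}^{pm}\frac{(-1)^{j+pm}}{j!\,(r-pm+j)!}\,g^{r-pm+j}\,\mathrm c^j(\omega^m).$$ Let $k>i\ge0$ be integers. Then $$h_{(r,pk-pi)}(\omega)=0\quad\text{for all integers } r\ge0 \text{ with } n-pk+pi+1\le r\le pk-pi.$$ In particular: (1) if $n=pk$ is a multiple of $p$, then $h_{(r,n-pi)}(\omega)=0$ for $pi+1\le r\le n-pi$; (2) if $n=pk+1$, then $h_{(r,n-pi-1)}(\omega)=0$ for $pi+2\le r\le n-pi-1$.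
   Context: Let $(V,g)$ be a Euclidean real vector space of dimension $n$. A $(p,q)$ double form is an element of $\mathcal D^{p,q}=\Lambda^pV^*\otimes\Lambda^qV^*$, identified with a bilinear form $\Lambda^pV\times\Lambda^qV\to\mathbb R$. Exterior product: $(\theta_1\otimes\theta_2)(\theta_3\otimes\theta_4)=(\theta_1\wedge\theta_3)\otimes(\theta_2\wedge\theta_4)$, extended bilinearly; all products and powers in the claim are exterior products, with zeroth power $1$; $g$ is regarded as a $(1,1)$ double form. Contraction $\mathrm c:\mathcal D^{p,q}\to\mathcal D^{p-1,q-1}$: $\mathrm c\,\omega(x_1\wedge\dots\wedge x_{p-1},y_1\wedge\dots\wedge y_{q-1})=\sum_{j=1}^n\omega(e_j\wedge x_1\wedge\dots\wedge x_{p-1},e_j\wedge y_1\wedge\dots\wedge y_{q-1})$ for any orthonormal basis $(e_j)$ of $V$; $\mathrm c^j$ is the $j$-fold iterate ($\mathrm c^0$ is the identity). A $(0,0)$ double form is a scalar. A $(p,p)$ double form $\omega$ is symmetric if $\omega(u,v)=\omega(v,u)$ for $u,v\in\Lambda^pV$, and satisfies the first Bianchi identity if $\sum_{j=1}^{p+1}(-1)^j\omega(x_1\wedge\dots\widehat{x_j}\dots\wedge x_{p+1},\;x_j\wedge y_1\wedge\dots\wedge y_{p-1})=0$ for all vectors $x_1,\dots,x_{p+1},y_1,\dots,y_{p-1}\in V$. Background: for $0\le r\le n-pm$ one has $h_{(r,pm)}(\omega)=*\frac{g^{n-pm-r}\omega^m}{(n-pm-r)!}$ with $*$ the double Hodge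 star; the sum in the claim is the definition used when $r>n-pm$, which is the case here. *)

(* Defs.v *)
From HB Require Import structures.
From mathcomp Require Import all_boot all_order all_algebra.
From mathcomp Require Import sesquilinear reals.

Set Implicit Arguments.
Unset Strict Implicit.
Unset Printing Implicit Defensive.

Import Order.TTheory GRing.Theory Num.Theory.
Local Open Scope ring_scope.

(* An element of Lambda^p V* is an alternating p-linear form on V, viewed as a
   function on all finite sequences of vectors that vanishes on sequences of
   length other than p.  In the same way a (p, q) double form, that is, a
   bilinear form on Lambda^p V x Lambda^q V, is a function of two sequences
   (x_1, ..., x_p) and (y_1, ..., y_q), alternating multilinear in each of them:
   [w [:: x_1; ...; x_p] [:: y_1; ...; y_q]] stands for
   w (x_1 /\ ... /\ x_p, y_1 /\ ... /\ y_q).  All bidegrees thus live in one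
   type, so that the product, the contraction and sums need no casts between
   provably equal degrees. *)

Section DoubleForms.
Variables (R : realType) (V : vectType R).

Definition mform := seq V -> R.
Definition dform := seq V -> seq V -> R.

Definition is_altform (p : nat) (a : mform) : Prop :=
  [/\ forall s, size s != p -> a s = 0,
      forall s1 s2 (t : R) (u v : V),
        a (s1 ++ (t *: u + v) :: s2) = t * a (s1 ++ u :: s2) + a (s1 ++ v :: s2)
    & forall s1 s2 s3 (u : V), a (s1 ++ u :: s2 ++ u :: s3) = 0].

Definition is_dform (p q : nat) (w : dform) : Prop :=
  (forall y, is_altform p (w^~ y)) /\ (forall x, is_altform q (w x)).

(* A bit mask [m] stands for the shuffle that lists the positions marked [true]
   first and then those marked [false], each in increasing order. *)
Fixpoint shuffle_inv (m : bitseq) : nat :=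
  if m is b :: m' then ((if b then 0 else count id m') + shuffle_inv m')%N
  else 0%N.

Definition shuffle_sign (m : bitseq) : R := (-1) ^+ shuffle_inv m.

(* Normalised so that (t_1 /\ ... /\ t_p) (x_1, ..., x_p) = det (t_i x_j)
   for linear forms t_i. *)
Definition wedge (a b : mform) : mform := fun x =>
  \sum_(m : (size x).-tuple bool)
    shuffle_sign m * (a (mask m x) * b (mask (map negb m) x)).

Definition tensor (a b : mform) : dform := fun x y => a x * b y.

(* The bilinear extension of (a (x) b) (c (x) d) = (a /\ c) (x) (b /\ d), see
   [dprod_tensor], [dprodDl], [dprodDr], [dprodZl] and [dprodZr]. *)
Definition dprod (w1 w2 : dform) : dform := fun x y =>
  \sum_(m : (size x).-tuple bool) \sum_(l : (size y).-tuple bool)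
    shuffle_sign m * shuffle_sign l *
    (w1 (mask m x) (mask l y) *
     w2 (mask (map negb m) x) (mask (map negb l) y)).

Lemma dprod_tensor (a b c d : mform) x y :
  dprod (tensor a b) (tensor c d) x y = tensor (wedge a c) (wedge b d) x y.
Proof.
rewrite /dprod /tensor /wedge mulr_suml; apply: eq_bigr => m _.
rewrite mulr_sumr; apply: eq_bigr => l _.
by rewrite [RHS]mulrACA (mulrACA (a _)) /=.
Qed.

Lemma dprodDl (w1 w2 w : dform) x y :
  dprod (fun x y => w1 x y + w2 x y) w x y = dprod w1 w x y + dprod w2 w x y.
Proof.
rewrite /dprod -big_split; apply: eq_bigr => m _.
by rewrite -big_split; apply: eq_bigr => l _ /=; rewrite -mulrDr -mulrDl.
Qed.

Lemma dprodDr (w w1 w2 : dform) x y :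
  dprod w (fun x y => w1 x y + w2 x y) x y = dprod w w1 x y + dprod w w2 x y.
Proof.
rewrite /dprod -big_split; apply: eq_bigr => m _.
by rewrite -big_split; apply: eq_bigr => l _ /=; rewrite -!mulrDr.
Qed.

Lemma dprodZl (t : R) (w1 w : dform) x y :
  dprod (fun x y => t * w1 x y) w x y = t * dprod w1 w x y.
Proof.
rewrite /dprod mulr_sumr; apply: eq_bigr => m _.
by rewrite mulr_sumr; apply: eq_bigr => l _; rewrite -(mulrA t) mulrCA.
Qed.

Lemma dprodZr (t : R) (w w1 : dform) x y :
  dprod w (fun x y => t * w1 x y) x y = t * dprod w w1 x y.
Proof.
rewrite /dprod mulr_sumr; apply: eq_bigr => m _.
by rewrite mulr_sumr; apply: eq_bigr => l _; rewrite !(mulrCA _ t).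
Qed.

Definition dform1 : dform := fun x y => (nilp x && nilp y)%:R.

Definition dpow (w : dform) (m : nat) : dform := iter m (dprod w) dform1.

Definition metric_dform (g : {dot V for (@idfun R)}) : dform := fun x y =>
  if (x, y) is ([:: u], [:: v]) then g u v else 0.

Definition contr n (e : n.-tuple V) (w : dform) : dform := fun x y =>
  \sum_(j < n) w (tnth e j :: x) (tnth e j :: y).

Definition dsymmetric (w : dform) : Prop := forall x y, w x y = w y x.

(* The indices are shifted by one: [j] runs over 0, ..., p. *)
Definition first_bianchi (p : nat) (w : dform) : Prop :=
  forall x y : seq V, size x = p.+1 -> size y = p.-1 ->
    \sum_(j < p.+1)
      (-1) ^+ j.+1 * w (take j x ++ drop j.+1 x) (nth 0 x j :: y) = 0.

(* [hform g e p w r m] is h_(r, pm)(w).  The truncated subtraction [p * m - r]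
   is max {0, pm - r}, and [r + j - p * m] is never truncated in this range. *)
Definition hform (g : {dot V for (@idfun R)}) n (e : n.-tuple V)
    (p : nat) (w : dform) (r m : nat) : dform := fun x y =>
  \sum_((p * m - r)%N <= j < (p * m).+1)
    (-1) ^+ (j + p * m) / ((j`! * (r + j - p * m)`!)%N)%:R *
    dprod (dpow (metric_dform g) (r + j - p * m))
          (iter j (contr e) (dpow w m)) x y.

End DoubleForms.

(* Main.v *)
(* On (d, d) double forms, multiplication by g and the contraction c satisfy the
   sl_2 relation c g - g c = n - 2d.  Hence, for W = w^m of degree q = pm and
   with C(h, k) a generalised binomial coefficient,
     c^a/a! g^b/b! W = sum_k C(n - 2q + a - b, k) g^(b-k)/(b-k)! c^(a-k)/(a-k)! W.
   Put N = q + r - n >= 1.  For 0 <= l < N the form g^(r-l) W has degree greater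
   than n and vanishes, so taking a = q - l and b = r - l gives
     sum_k C(-N, k) T_(k+l) = 0,  T_k = g^(r-k)/(r-k)! c^(q-k)/(q-k)! W.
   By Pascal's rule, adding the relations for l and l + 1 replaces -N by -N + 1;
   after N - 1 such steps only sum_k C(-1, k) T_k = 0 is left, and since
   C(-1, k) = (-1)^k this sum is h_(r, pm)(w). *)

From HB Require Import structures.
Require Import Defs.
From mathcomp Require Import all_boot all_order all_algebra.
From mathcomp Require Import sesquilinear reals boolp functions ring zify.

Set Implicit Arguments.
Unset Strict Implicit.
Unset Printing Implicit Defensive.

Import Order.TTheory GRing.Theory Num.Theory.
Local Open Scope ring_scope.

(** * Binomial coefficients with an arbitrary upper argument *)

Section GeneralizedBinomial.
Variable R : numFieldType.

Fixpoint gbin (h : R) k : R :=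
  if k is k'.+1 then gbin h k' * (h - k'%:R) / k'.+1%:R else 1.

Lemma gbinS h k : k.+1%:R * gbin h k.+1 = (h - k%:R) * gbin h k.
Proof. by rewrite /= mulrCA divff ?pnatr_eq0// mulr1 mulrC. Qed.

(** Induction on [k]: once the denominator [k + 2] is cleared, the recurrence [gbinS] leaves a
    polynomial identity. *)
Lemma gbin_pascal h k : gbin (h + 1) k.+1 = gbin h k.+1 + gbin h k.
Proof.
elim: k => [|k IH]; first by rewrite /=; field.
apply: (mulfI (_ : k.+2%:R != 0 :> R)); first by rewrite pnatr_eq0.
rewrite mulrDr [LHS]gbinS [X in _ = X + _]gbinS IH.
move: (gbin h k.+1) (gbin h k) (gbinS h k) => G' G e.
have -> : k.+2%:R * G' = k.+1%:R * G' + G' by rewrite -natr1; ring.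
by rewrite e -natr1; ring.
Qed.

Lemma gbinN1 k : gbin (-1) k = (-1) ^+ k.
Proof.
elim: k => [//|k IH]; rewrite /= IH exprS.
by rewrite -opprD nat1r mulN1r mulrN mulNr mulfK ?pnatr_eq0.
Qed.

End GeneralizedBinomial.

(** * Normal ordering of contractions and metric factors *)

Section LadderOperators.
(** The reordering uses only a grading and the commutator, so it is done for abstract operators.
    Later [c] is the contraction, [g] the product with the metric, and [deg d] means bidegree (d,
    d); it is a predicate because 0 has every degree. *)
Variables (R : numFieldType) (M : lmodType R) (c g : {linear M -> M}).
Variables (deg : nat -> M -> Prop) (n : nat).
Hypothesis deg_c : forall d x, deg d.+1 x -> deg d (c x).
Hypothesis deg_g : forall d x, deg d x -> deg d.+1 (g x).
Hypothesis deg_Z : forall d t x, deg d x -> deg d (t *: x).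
Hypothesis deg_gtn : forall d x, deg d x -> (n < d)%N -> x = 0.
Hypothesis commutator : forall d x, deg d x ->
  c (g x) = g (c x) + (n%:R - (2 * d)%:R) *: x.

Definition divpow (f : M -> M) a x : M := a`!%:R^-1 *: iter a f x.

Lemma divpowS (f : {linear M -> M}) a x :
  f (divpow f a x) = a.+1%:R *: divpow f a.+1 x.
Proof.
rewrite /divpow linearZ scalerA factS natrM invfM mulrA divff ?mul1r//.
by rewrite pnatr_eq0.
Qed.

Lemma divpowZ (f : {linear M -> M}) a t x :
  divpow f a (t *: x) = t *: divpow f a x.
Proof.
rewrite /divpow scalerA mulrC -scalerA; congr (_ *: _).
by elim: a => [//|a /= ->]; rewrite linearZ.
Qed.

Lemma deg_iter_c a d x : deg (a + d) x -> deg d (iter a c x).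
Proof. by elim: a d => [//|a IH] d h; apply/deg_c/IH; rewrite addnS. Qed.

Lemma deg_iter_g a d x : deg d x -> deg (a + d) (iter a g x).
Proof. by move=> h; elim: a => [//|a IH]; apply: deg_g. Qed.

(** Passing [c] over the copy of [g] that acts in degree d + i costs n - 2d - 2i; summing over i =
    0, ..., b gives (b + 1)(n - 2d - b). *)
Lemma c_iter_g b d x : deg d x ->
  c (iter b.+1 g x) = iter b.+1 g (c x) +
    (b.+1%:R * (n%:R - (2 * d)%:R - b%:R)) *: iter b g x.
Proof.
move=> dx; elim: b => [|b IH].
  by rewrite [LHS](commutator dx) subr0 mul1r.
rewrite iterS (commutator (deg_iter_g _ dx)) IH linearD linearZ -addrA.
rewrite -scalerDl; congr (_ + _ *: _).
rewrite !mulnDr !natrD !natrM -!natr1; ring.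
Qed.

Lemma c_divpow_g b d x : deg d x ->
  c (divpow g b.+1 x) = divpow g b.+1 (c x) +
    (n%:R - (2 * d)%:R - b%:R) *: divpow g b x.
Proof.
move=> dx; rewrite linearZ/= (c_iter_g _ dx) scalerDr; congr (_ + _).
rewrite /divpow !scalerA; congr (_ *: _); rewrite factS natrM.
by field; rewrite nat1r !pnatr_eq0 -lt0n fact_gt0.
Qed.

(** For a = q and b = r this is T_k. The test prevents truncated subtraction from producing spurious
    terms with exponent 0. *)
Definition gc_term x a b k : M :=
  if ((k <= a) && (k <= b))%N then divpow g (b - k) (divpow c (a - k) x)
  else 0.

Lemma deg_divpow_c a d x : deg (a + d) x -> deg d (divpow c a x).
Proof. by move=> dx; apply/deg_Z/deg_iter_c. Qed.

(** The new [c] either joins the other contractions, which keeps [k], or is absorbed by a factor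
    [g], which raises [k] by one. The second coefficient is written as h + a - k + 1 with h = n - 2d
    + a - b, the upper argument of the binomials in the induction below. *)
Lemma c_gc_term d x a b k : deg d x -> (a <= d)%N ->
  c (gc_term x a b k) = (a.+1%:R - k%:R) *: gc_term x a.+1 b k +
    (n%:R - (2 * d)%:R + a%:R - b%:R + a%:R - k%:R + 1) *: gc_term x a.+1 b k.+1.
Proof.
move=> dx ad; rewrite /gc_term ltnS.
have [ka|ak] := leqP k a; last first.
  rewrite linear0 scaler0 addr0; case: ifP => [/andP[ka1 _]|_].
    (* Here the term on the right may be nonzero, but its coefficient vanishes. *)
    have -> : k = a.+1 by lia.
    by rewrite subrr scale0r.
  by rewrite scaler0.
have -> : (k <= a.+1)%N by lia.
have [kb|bk] := leqP k b; last first.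
  have -> : (k < b)%N = false by lia.
  by rewrite linear0 andbF !scaler0 addr0.
rewrite /= subSS subSn//.
have dy : deg (d - (a - k)) (divpow c (a - k) x).
  by apply: deg_divpow_c; rewrite subnKC//; lia.
have [kb'|bk'] := ltnP k b.
  have -> : (b - k)%N = (b - k.+1).+1 by lia.
  rewrite (c_divpow_g _ dy) divpowS divpowZ.
  congr (_ *: _ + _ *: _); first by rewrite -subSn// natrB// ltnW.
  rewrite !natrM !natrB//; last by lia.
  by rewrite -natr1; ring.
have -> : (b - k)%N = 0%N by lia.
rewrite scaler0 addr0 /divpow/= linearZ/= -/(divpow c _ _) divpowS.
rewrite [LHS]scalerA mulrC -scalerA; congr (_ *: _).
by rewrite -natrB 1?ltnW// subSn.
Qed.

(** Induction on [a], applying [c] to every summand. Any bound [K > b] gives the same sum, since the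
    terms with k > b are zero. *)
Lemma divpow_c_divpow_g d x a b K : deg d x -> (a <= d)%N -> (b < K)%N ->
  divpow c a (divpow g b x) =
    \sum_(k < K) gbin (n%:R - (2 * d)%:R + a%:R - b%:R) k *: gc_term x a b k.
Proof.
move=> dx + bK; elim: a => [|a IH] ad.
  rewrite (bigD1 (Ordinal (leq_ltn_trans (leq0n b) bK)))//= big1 ?addr0 => [|k].
    by rewrite /gc_term/= scale1r /divpow /= invr1 !scale1r subn0.
  rewrite -val_eqE /= /gc_term leqn0 => /negPf ->; exact: scaler0.
apply: (scalerI (_ : a.+1%:R != 0 :> R)); first by rewrite pnatr_eq0.
rewrite -divpowS IH; last exact: ltnW.
set h := (_ - b%:R); set h' := (_ - b%:R).
have hh' : h' = h + 1 by rewrite /h /h' -natr1; ring.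
rewrite linear_sum scaler_sumr/=.
case: K bK {IH} => // K bK.
have Ec k : c (gbin h k *: gc_term x a b k) =
    ((a.+1%:R - k%:R) * gbin h k) *: gc_term x a.+1 b k +
    ((h + a%:R - k%:R + 1) * gbin h k) *: gc_term x a.+1 b k.+1.
  rewrite linearZ/= (c_gc_term _ _ dx); last exact: ltnW.
  by rewrite scalerDr !scalerA -/h ![gbin h k * _]mulrC.
under eq_bigr do rewrite Ec.
(* The second sum is shifted by one against the first: the head of the first and the last term of
   the second, which is zero, are split off. *)
rewrite big_split/= big_ord_recl [in X in _ + X]big_ord_recr/=.
have -> : gc_term x a.+1 b K.+1 = 0.
  by rewrite /gc_term (_ : (K < b)%N = false) ?andbF//; lia.
rewrite scaler0 addr0 -addrA -big_split [RHS]big_ord_recl/= subr0 mulr1 scale1r.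
congr (_ + _); apply: eq_bigr => k _.
rewrite -scalerDl scalerA; congr (_ *: _).
rewrite hh' -[LHS]/(_ * gbin h k.+1 + _).
rewrite -[X in a.+1%:R * X]/(gbin (h + 1) k.+1) gbin_pascal.
rewrite /bump add1n.
(* After Pascal's rule the two sides differ by (h - k) C(h, k) - (k + 1) C(h, k + 1), which is zero
   by [gbinS]. *)
move: (gbin h k.+1) (gbin h k) (gbinS h k) => G' G e.
apply/eqP; rewrite -subr_eq0; apply/eqP.
transitivity ((h - k%:R) * G - k.+1%:R * G'); last by rewrite e subrr.
by rewrite -!natr1; ring.
Qed.

Lemma gc_term_shift x a b k l : (l <= a)%N -> (l <= b)%N ->
  gc_term x (a - l) (b - l) k = gc_term x a b (l + k).
Proof.
move=> la lb; rewrite /gc_term -!subnDA.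
by rewrite !leq_subRL// !(addnC l).
Qed.

Lemma alternating_gc_sum_eq0 q r x : deg q x -> (r <= q)%N -> (n < q + r)%N ->
  \sum_(k < r.+1) (-1) ^+ k *: gc_term x q r k = 0.
Proof.
move=> dx rq nqr.
set N := (q + r - n)%N.
(* [t] counts the uses of Pascal's rule; each of them costs one of the [N] initial relations. *)
have shifted t l : (t + l < N)%N ->
    \sum_(k < r.+1) gbin (t%:R - N%:R) k *: gc_term x q r (l + k) = 0.
  elim: t l => [|t IH] l tl.
    (* [N] may exceed [r]; for l > r every term of the relation is zero. *)
    have [rl|lr] := ltnP r l.
      apply: big1 => k _; rewrite /gc_term (_ : (l + k <= r)%N = false) ?andbF ?scaler0//.
      by lia.
    transitivity (divpow c (q - l) (divpow g (r - l) x)); last first.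
      rewrite [divpow g _ _](@deg_gtn (r - l + q));
        [|by apply/deg_Z/deg_iter_g|by lia].
      by rewrite -[X in divpow _ _ X](scale0r (0 : M)) divpowZ scale0r.
    rewrite (@divpow_c_divpow_g q _ _ _ r.+1)//; [|by lia..].
    apply: eq_bigr => k _; rewrite gc_term_shift//; last by lia.
    (* The upper argument n - 2q + (q - l) - (r - l) equals -N for every [l]. *)
    congr (gbin _ _ *: _); rewrite /N !natrB ?natrD ?natrM//; [ring|lia..].
  have IHl : \sum_(k < r.+1) gbin (t%:R - N%:R) k *: gc_term x q r (l + k) = 0.
    by apply: IH; lia.
  (* The relation for l + 1 without its last term, whose index l + 1 + r exceeds [r]; it now aligns
     with the tail of the relation for [l]. *)
  have IHl1 : \sum_(k < r) gbin (t%:R - N%:R) k *: gc_term x q r (l + k.+1) = 0.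
    rewrite -[RHS](IH l.+1); last by lia.
    rewrite big_ord_recr/= [X in _ + _ *: X](_ : _ = 0).
      by rewrite scaler0 addr0; apply: eq_bigr => k _; rewrite addSnnS.
    by rewrite /gc_term (_ : (l.+1 + r <= r)%N = false) ?andbF//; lia.
  apply: etrans (etrans (congr2 +%R IHl IHl1) (addr0 0)).
  rewrite big_ord_recl [in RHS]big_ord_recl -addrA -big_split.
  congr (_ + _); apply: eq_bigr => k _; rewrite !lift0.
  apply: etrans (scalerDl _ _ _); congr (_ *: _).
  by rewrite -gbin_pascal -natr1; congr (gbin _ _); ring.
rewrite -[RHS](shifted N.-1 0%N); last by lia.
apply: eq_bigr => k _; rewrite -gbinN1; congr (gbin _ _ *: _).
by rewrite -[X in _ - X%:R]prednK ?subn_gt0// -natr1; ring.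
Qed.

End LadderOperators.

(** * The exterior product of double forms *)

HB.instance Definition _ (R : realType) (V : vectType R) :=
  GRing.Lmodule.copy (dform V) (seq V -> seq V -> R^o).

Section DoubleFormAlgebra.
Variables (R : realType) (V : vectType R).
Implicit Types (w a b : dform V) (x y s : seq V) (u v : V).

(* [insl u] and [insr v] insert a vector in the first slot (interior products),
   [invl] and [invr] are the grade involutions that make them antiderivations. *)
Definition dtr w : dform V := fun x y => w y x.
Definition insl u w : dform V := fun x y => w (u :: x) y.
Definition insr v w : dform V := fun x y => w x (v :: y).
Definition invl w : dform V := fun x y => (-1) ^+ size x * w x y.
Definition invr w : dform V := fun x y => (-1) ^+ size y * w x y.

Lemma dformP a b : (forall x y, a x y = b x y) -> a = b.
Proof. by move=> h; apply/funext => x; apply/funext => y. Qed.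

Lemma dprod_linearl w t a b :
  dprod (t *: a + b) w = t *: dprod a w + dprod b w.
Proof.
apply: dformP => x y.
by rewrite [LHS](dprodDl (t *: a) b) [X in X + _]dprodZl.
Qed.

Lemma dprod_linearr w t a b :
  dprod w (t *: a + b) = t *: dprod w a + dprod w b.
Proof.
apply: dformP => x y.
by rewrite [LHS](dprodDr w (t *: a) b) [X in X + _]dprodZr.
Qed.

HB.instance Definition _ w := GRing.isLinear.Build R (dform V) (dform V) *:%R
  (dprod w) (dprod_linearr w).

Lemma dprodD a b w : dprod (a + b) w = dprod a w + dprod b w.
Proof. by rewrite -[a]scale1r dprod_linearl !scale1r. Qed.

Lemma dprod0 w : dprod 0 w = 0.
Proof. by have := dprod_linearl w (-1) 0 0; rewrite !scaleN1r oppr0 addr0 addNr. Qed.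

Lemma dprod_scalel t a w : dprod (t *: a) w = t *: dprod a w.
Proof. by rewrite -[t *: a]addr0 dprod_linearl dprod0 addr0. Qed.

Lemma dprodN a w : dprod (- a) w = - dprod a w.
Proof. by rewrite -scaleN1r dprod_scalel scaleN1r. Qed.

(** Through this symmetry, facts about the second slot follow from those about the first. *)
Lemma dprod_tr a b : dprod (dtr a) (dtr b) = dtr (dprod a b).
Proof.
apply: dformP => x y; rewrite /dtr /dprod exchange_big/=.
by apply: eq_bigr => l _; apply: eq_bigr => m _; rewrite [shuffle_sign _ _ * _]mulrC.
Qed.

Lemma big_tuple_cons n (F : n.+1.-tuple bool -> R) :
  \sum_m F m = \sum_(m : n.-tuple bool) F [tuple of true :: m] +
               \sum_(m : n.-tuple bool) F [tuple of false :: m].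
Proof.
pose f (bm : bool * n.-tuple bool) := [tuple of bm.1 :: bm.2].
rewrite (reindex f) /=; last first.
  exists (fun m => (thead m, [tuple of behead m])) => [[c m] _|m _].
    by congr pair; apply: val_inj.
  by rewrite /f/= -tuple_eta.
rewrite -(pair_bigA _ (fun c m => F (f (c, m)))) /=.
by rewrite big_bool.
Qed.

(* The sign is produced by the summands whose mask starts with [false]: the
   first vector then moves past all the arguments of [a]. *)
Lemma insl_dprod u a b :
  insl u (dprod a b) = dprod (insl u a) b + dprod (invl a) (insl u b).
Proof.
apply: dformP => x y; rewrite /insl /invl.
rewrite [LHS]big_tuple_cons; congr (_ + _); apply: eq_bigr => m _ //=.
apply: eq_bigr => l _ /=.
rewrite /shuffle_sign /= exprD size_mask ?size_tuple//; ring.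
Qed.

Lemma insr_dprod v a b :
  insr v (dprod a b) = dprod (insr v a) b + dprod (invr a) (insr v b).
Proof.
have trl : dprod (insl v (dtr a)) (dtr b) = dtr (dprod (insr v a) b).
  exact: dprod_tr.
have trr : dprod (invl (dtr a)) (insl v (dtr b)) =
    dtr (dprod (invr a) (insr v b)) by exact: dprod_tr.
have := insl_dprod v (dtr a) (dtr b).
by rewrite trl trr dprod_tr => /(congr1 dtr).
Qed.

Lemma dprod_nil a b : dprod a b [::] [::] = a [::] [::] * b [::] [::].
Proof.
have t0 (m : 0.-tuple bool) : m == [tuple] by rewrite tuple0.
rewrite /dprod (big_pred1 [tuple]) => [|m]; last by rewrite /= t0.
rewrite (big_pred1 [tuple]) => [|m]; last by rewrite /= t0.
by rewrite /shuffle_sign /= mulr1 mul1r.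
Qed.

Lemma size_mask_compl (T : Type) (m : bitseq) (s : seq T) : size m = size s ->
  size s = (size (mask m s) + size (mask (map negb m) s))%N.
Proof.
move=> ms; rewrite !size_mask ?size_map// count_map -ms.
by rewrite -(count_predC id m).
Qed.

Lemma invl_dprod a b : invl (dprod a b) = dprod (invl a) (invl b).
Proof.
apply: dformP => x y; rewrite /invl /dprod mulr_sumr; apply: eq_bigr => m _.
rewrite mulr_sumr; apply: eq_bigr => l _.
rewrite [in (-1) ^+ size x](@size_mask_compl _ m x) ?size_tuple// exprD; ring.
Qed.

Lemma invr_dprod a b : invr (dprod a b) = dprod (invr a) (invr b).
Proof.
have tr : dprod (invl (dtr a)) (invl (dtr b)) =
    dtr (dprod (invr a) (invr b)) by exact: dprod_tr.
have := invl_dprod (dtr a) (dtr b).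
by rewrite tr dprod_tr => /(congr1 dtr).
Qed.

Lemma dformDE a b x y : (a + b) x y = a x y + b x y. Proof. by []. Qed.

Lemma dprod_consl u x y a b :
  dprod a b (u :: x) y = dprod (insl u a) b x y + dprod (invl a) (insl u b) x y.
Proof. by rewrite -dformDE -insl_dprod. Qed.

Lemma dprod_consr v x y a b :
  dprod a b x (v :: y) = dprod (insr v a) b x y + dprod (invr a) (insr v b) x y.
Proof. by rewrite -dformDE -insr_dprod. Qed.

(** No shuffles are composed: the antiderivation rules remove one vector at a time from [x], then
    from [y], until only a product of scalars is left. *)
Lemma dprodA a b c : dprod (dprod a b) c = dprod a (dprod b c).
Proof.
apply: dformP => x; elim: x a b c => [|u x IH] a b c y; last first.
  rewrite !dprod_consl !insl_dprod dprodD linearD/= !dformDE.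
  by rewrite !IH invl_dprod IH addrA.
elim: y a b c => [|v y IH] a b c; last first.
  rewrite !dprod_consr !insr_dprod dprodD linearD/= !dformDE.
  by rewrite !IH invr_dprod IH addrA.
by rewrite !dprod_nil mulrA.
Qed.

Lemma dprod1 w : dprod (@dform1 R V) w = w.
Proof.
have i1 u : insl u (@dform1 R V) = 0 by exact: dformP.
have i2 v : insr v (@dform1 R V) = 0.
  by apply: dformP => x y; rewrite /insr /dform1 andbF.
have j1 : invl (@dform1 R V) = @dform1 R V.
  by apply: dformP => -[|u x] y; rewrite /invl ?expr0 ?mul1r// /dform1 mulr0.
have j2 : invr (@dform1 R V) = @dform1 R V.
  apply: dformP => x [|u y]; rewrite /invr ?expr0 ?mul1r//.
  by rewrite /dform1 andbF mulr0.
apply: dformP => x; elim: x w => [|u x IH] w y; last first.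
  by rewrite dprod_consl i1 j1 dprod0 IH; exact: add0r.
elim: y w => [|v y IH] w; last first.
  by rewrite dprod_consr i2 j2 dprod0 IH; exact: add0r.
by rewrite dprod_nil /dform1 mul1r.
Qed.

(** Turns multiplication by a power of the metric into the iterated operator of the abstract
    calculation. *)
Lemma dprod_dpow a m w : dprod (dpow a m) w = iter m (dprod a) w.
Proof. by elim: m => [|m IH]; rewrite ?dprod1 //= dprodA IH. Qed.

(** * Multilinearity and alternation of products *)

Definition multilinear_l w := forall x1 x2 (t : R) u v y,
  w (x1 ++ (t *: u + v) :: x2) y = t * w (x1 ++ u :: x2) y + w (x1 ++ v :: x2) y.

(** Testing adjacent repetitions suits induction on the prefix [x1]; for multilinear forms
    [alternating_l_far] recovers the general case. *)
Definition alternating_l w := forall x1 x2 u y, w (x1 ++ u :: u :: x2) y = 0.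

Lemma multilinear_l_insl u w : multilinear_l w -> multilinear_l (insl u w).
Proof. by move=> lw x1; exact: lw (u :: x1). Qed.

Lemma multilinear_l_invl w : multilinear_l w -> multilinear_l (invl w).
Proof.
by move=> lw x1 x2 t u v y; rewrite /invl lw !size_cat/=; ring.
Qed.

Lemma alternating_l_insl u w : alternating_l w -> alternating_l (insl u w).
Proof. by move=> aw x1; exact: aw (u :: x1). Qed.

Lemma alternating_l_invl w : alternating_l w -> alternating_l (invl w).
Proof. by move=> aw x1 x2 u y; rewrite /invl aw mulr0. Qed.

Lemma insl_lin w t u v : multilinear_l w ->
  insl (t *: u + v) w = t *: insl u w + insl v w.
Proof. by move=> lw; apply: dformP => x y; exact: (lw [::]). Qed.

Lemma multilinear_l_dprod a b :
  multilinear_l a -> multilinear_l b -> multilinear_l (dprod a b).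
Proof.
move=> + + x1; elim: x1 a b => [|z x1 IH] a b la lb x2 t u v y /=; last first.
  rewrite !dprod_consl !IH;
    try by do ?[apply: multilinear_l_insl|apply: multilinear_l_invl].
  by ring.
rewrite !dprod_consl !insl_lin// dprod_linearl linearP/= !dformDE.
rewrite -[(t *: dprod (insl u a) b) x2 y]/(t * _).
by rewrite -[(t *: dprod (invl a) (insl u b)) x2 y]/(t * _); ring.
Qed.

(** Once the prefix is removed, inserting [u] twice gives four terms. Two contain a double insertion
    into one factor and vanish; the other two cancel because [insl u] anticommutes with [invl]. *)
Lemma alternating_l_dprod a b :
  alternating_l a -> alternating_l b -> alternating_l (dprod a b).
Proof.
move=> + + x1; elim: x1 a b => [|z x1 IH] a b la lb x2 u y /=; last first.
  rewrite dprod_consl !IH ?addr0//;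
    by do ?[apply: alternating_l_insl|apply: alternating_l_invl].
have i2 c : alternating_l c -> insl u (insl u c) = 0.
  by move=> ac; apply: dformP => x z; exact: (ac [::]).
have ic c : insl u (invl c) = - invl (insl u c).
  apply: dformP => x z; rewrite /insl /invl /= exprS.
  by rewrite mulN1r mulNr.
rewrite !dprod_consl !i2// dprod0 linear0 ic dprodN.
rewrite -[(0 : dform V) x2 y]/(0 : R) add0r addr0.
exact: subrr.
Qed.

End DoubleFormAlgebra.

(** * Bidegrees of double forms *)

Section Degrees.
Variables (R : realType) (V : vectType R).
Implicit Types (w a b : dform V) (x y : seq V).

Definition has_degree p q w :=
  [/\ forall x y, (size x != p) || (size y != q) -> w x y = 0,
      multilinear_l w /\ multilinear_l (dtr w)
    & alternating_l w /\ alternating_l (dtr w)].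

Lemma is_dform_has_degree p q w : is_dform p q w -> has_degree p q w.
Proof.
move=> [wl wr]; split.
- by move=> x y /orP[]; [case: (wl y) => h _ _|case: (wr x) => h _ _]; exact: h.
- by split=> x1 x2 t u v y; [case: (wl y) => _ h _|case: (wr y) => _ h _]; exact: h.
by split=> x1 x2 u y; [case: (wl y) => _ _ h|case: (wr y) => _ _ h]; exact: h _ [::] _ _.
Qed.

Lemma has_degreeZ p q (t : R) w : has_degree p q w -> has_degree p q (t *: w).
Proof.
have ZE (a : dform V) x y : (t *: a) x y = t * a x y by [].
have mZ a : multilinear_l a -> multilinear_l (t *: a).
  by move=> ml x1 x2 s u v y; rewrite !ZE ml; ring.
have aZ a : alternating_l a -> alternating_l (t *: a).
  by move=> al x1 x2 u y; rewrite ZE al mulr0.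
move=> [hs [ml mr] [al ar]]; split.
- by move=> x y /hs; rewrite ZE => ->; rewrite mulr0.
- by split; [exact: mZ|exact: (mZ _ mr)].
by split; [exact: aZ|exact: (aZ _ ar)].
Qed.

Lemma has_degree_dprod p q p' q' a b : has_degree p q a ->
  has_degree p' q' b -> has_degree (p + p')%N (q + q')%N (dprod a b).
Proof.
move=> [hs [ml mr] [al ar]] [hs' [ml' mr'] [al' ar']]; split.
- move=> x y xy; rewrite /dprod big1// => m _; rewrite big1// => l _.
  have [h|] := boolP ((size (mask m x) != p) || (size (mask l y) != q)).
    by rewrite hs// mul0r mulr0.
  rewrite negb_or !negbK => /andP[/eqP xp /eqP yq].
  rewrite hs' ?mulr0//; apply: contraLR xy; rewrite !negb_or !negbK.
  move=> /andP[/eqP xp' /eqP yq'].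
  rewrite (@size_mask_compl _ m x) ?size_tuple// xp xp'.
  by rewrite (@size_mask_compl _ l y) ?size_tuple// yq yq' !eqxx.
- by split; rewrite -?dprod_tr; exact: multilinear_l_dprod.
by split; rewrite -?dprod_tr; exact: alternating_l_dprod.
Qed.

Lemma has_degree1 : has_degree 0 0 (@dform1 R V).
Proof.
by split; [move=> [|u x] [|v y]|split=> -[|z x1] x2 t u v [|z' y]|
  split=> -[|z x1] x2 u [|z' y]]; rewrite /dtr /dform1 //= mulr0 addr0.
Qed.

Lemma has_degree_dpow p q w m :
  has_degree p q w -> has_degree (p * m)%N (q * m)%N (dpow w m).
Proof.
move=> hw; elim: m => [|m IH]; first by rewrite !muln0; exact: has_degree1.
by rewrite !mulnS; exact: has_degree_dprod.
Qed.

(** Polarisation: expand the zero value at the repeated vector u + v. *)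
Lemma alternating_l_swap w x1 x2 u v y :
  multilinear_l w -> alternating_l w ->
  w (x1 ++ u :: v :: x2) y = - w (x1 ++ v :: u :: x2) y.
Proof.
move=> ml al; apply/eqP; rewrite -addr_eq0; apply/eqP.
have := al x1 x2 (1 *: u + v) y; rewrite ml.
have E z : w (x1 ++ z :: 1 *: u + v :: x2) y =
    w (x1 ++ z :: u :: x2) y + w (x1 ++ z :: v :: x2) y.
  by have := ml (rcons x1 z) x2 1 u v y; rewrite !cat_rcons mul1r.
by rewrite !E !al mul1r add0r addr0.
Qed.

(** The first copy of [u] is swapped to the right until it meets the second. *)
Lemma alternating_l_far w x1 x2 x3 u y :
  multilinear_l w -> alternating_l w -> w (x1 ++ u :: x2 ++ u :: x3) y = 0.
Proof.
move=> ml al; elim: x2 x1 => [|v x2 IH] x1; first exact: al.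
by rewrite alternating_l_swap// -cat_rcons IH oppr0.
Qed.

End Degrees.

(** * Contraction and the metric *)

Section ContractionMetric.
Variables (R : realType) (V : vectType R) (g : {dot V for (@idfun R)}).
Variables (n : nat) (e : n.-tuple V).
Hypotheses (e_basis : basis_of {: V} e) (e_on : orthonormal g e).
Implicit Types (w a b : dform V) (x y : seq V) (u v : V) (phi : V -> R).

Lemma dot_sym u v : g u v = g v u.
Proof. by rewrite hermC GRing.expr0 mul1r. Qed.

Lemma orthonormal_nth (s : seq V) (i j : nat) : orthonormal g s ->
  (i < size s)%N -> (j < size s)%N -> g s`_i s`_j = (i == j)%:R.
Proof.
elim: s i j => [//|v s IH] i j /andP[/= /andP[/eqP v1 s1]].
rewrite /ortho_rec /= andbT => /andP[/allP vs so].
case: i j => [|i] [|j] //=; rewrite ?ltnS => si sj.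
- exact/eqP/vs/mem_nth.
- by rewrite dot_sym; exact/eqP/vs/mem_nth.
by rewrite IH// /orthonormal s1.
Qed.

Lemma dot_tnth i j : g (tnth e i) (tnth e j) = (i == j)%:R.
Proof. by rewrite !(tnth_nth 0) orthonormal_nth// size_tuple. Qed.

Lemma orthonormal_expansion v : v = \sum_j g (tnth e j) v *: tnth e j.
Proof.
have E := coord_basis e_basis (memvf v).
rewrite [LHS]E; apply: eq_bigr => j _; rewrite (tnth_nth 0); congr (_ *: _).
rewrite [in RHS]E linear_sumr (bigD1 j)//= linearZr_LR/=.
rewrite -!tnth_nth dot_tnth eqxx mulr1 big1 ?addr0// => k kj.
by rewrite linearZr_LR/= -!tnth_nth dot_tnth eq_sym (negPf kj) mulr0.
Qed.

Lemma multilinear_l_expansion w x1 x2 v y : multilinear_l w ->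
  w (x1 ++ v :: x2) y =
    \sum_j g (tnth e j) v * w (x1 ++ tnth e j :: x2) y.
Proof.
(* The empty sum in the induction below needs this value; it follows from linearity with t = -1 and
   u = v = 0. *)
move=> ml; have ml0 : w (x1 ++ 0 :: x2) y = 0.
  have := ml x1 x2 (-1) 0 0 y.
  by rewrite scaler0 addr0 => ->; rewrite mulN1r addNr.
rewrite {1}[v]orthonormal_expansion; elim: (index_enum _) => [|j r IH].
  by rewrite !big_nil.
by rewrite !big_cons ml IH.
Qed.

Lemma dform_sumE I (r : seq I) (F : I -> dform V) x y :
  (\sum_(i <- r) F i) x y = \sum_(i <- r) F i x y.
Proof. exact: (big_morph (fun w : dform V => w x y)). Qed.

(** The linear form [phi] as a (0, 1) double form. For phi = g(e_j, -) it is the dual vector e_j^*,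
    and it also arises by inserting a vector into the metric. *)
Definition rform phi : dform V := fun x y =>
  if (x, y) is ([::], [:: v]) then phi v else 0.

Lemma insl_rform u phi : insl u (rform phi) = 0.
Proof. exact: dformP. Qed.

Lemma invl_rform phi : invl (rform phi) = rform phi.
Proof.
by apply: dformP => -[|u x] y; rewrite /invl ?expr0 ?mul1r// /rform mulr0.
Qed.

Lemma insr_rform v phi : insr v (rform phi) = phi v *: @dform1 R V.
Proof.
apply: dformP => x y; rewrite -[RHS]/(phi v * _) /insr /rform /dform1.
by case: x y => [|u x] [|z y] /=; rewrite ?mulr0 ?mulr1.
Qed.

Lemma invr_rform phi : invr (rform phi) = - rform phi.
Proof.
apply: dformP => x y; rewrite -[RHS]/(- _) /invr /rform.
by case: x y => [|u x] [|z [|z' y]] /=; rewrite ?mulr0 ?oppr0 ?expr1 ?mulN1r.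
Qed.

Local Notation G := (metric_dform g).

Lemma insl_metric u : insl u G = rform (g u).
Proof. by apply: dformP => -[|u' x] y. Qed.

Lemma invl_metric : invl G = - G.
Proof.
apply: dformP => x y; rewrite -[RHS]/(- _) /invl /metric_dform.
by case: x y => [|u [|u' x]] [|z [|z' y]] /=; rewrite ?mulr0 ?oppr0 ?expr1 ?mulN1r.
Qed.

Lemma dtr_metric : dtr G = G.
Proof.
apply: dformP => x y; rewrite /dtr /metric_dform.
by case: x y => [|u [|u' x]] [|z [|z' y]] //; exact: dot_sym.
Qed.

Lemma insr_metric v : insr v G = dtr (rform (g v)).
Proof. by rewrite -insl_metric -[in RHS]dtr_metric. Qed.

Lemma invr_metric : invr G = - G.
Proof.
apply: dformP => x y; rewrite -[RHS]/(- _) /invr /metric_dform.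
by case: x y => [|u [|u' x]] [|z [|z' y]] /=; rewrite ?mulr0 ?oppr0 ?expr1 ?mulN1r.
Qed.

Lemma has_degree_metric : has_degree 1 1 G.
Proof.
have G0 x y : size x != 1%N -> G x y = 0 by case: x => [|u [|u' x]].
have ml : multilinear_l G.
  move=> x1 x2 t u v y; have [/nilP|x12] := boolP (nilp (x1 ++ x2)).
    case: x1 x2 => [|z x1] [|z' x2] //= _; case: y => [|z [|z' y]];
      by rewrite /metric_dform ?linearPl ?mulr0 ?addr0.
  have s0 z : size (x1 ++ z :: x2) != 1%N.
    by rewrite size_cat/= addnS eqSS -size_cat.
  by rewrite !G0// mulr0 addr0.
have al : alternating_l G.
  by move=> x1 x2 u y; rewrite G0// size_cat/= !addnS.
split; rewrite ?dtr_metric//.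
by move=> [|u [|u' x]] [|v [|v' y]].
Qed.

(* Euler's identity [sum_j e_j^* /\ i_(e_j) w = q w] on the second factor: the
   exterior analogue of [sum_j x_j d/dx_j] counting the degree. *)
Lemma euler_r w x y : multilinear_l (dtr w) -> alternating_l (dtr w) ->
  \sum_j dprod (rform (g (tnth e j))) (insr (tnth e j) w) x y =
    (size y)%:R * w x y.
Proof.
elim: x w => [|u x IH] w mr ar; last first.
  under eq_bigr => j _.
    rewrite dprod_consl insl_rform invl_rform dprod0.
    rewrite -[insl u _]/(insr (tnth e j) (insl u w)) add0r; over.
  apply: IH => [x1 x2 t v v' z|x1 x2 v z].
    exact: mr x1 x2 t v v' (u :: z).
  exact: ar x1 x2 v (u :: z).
elim: y w mr ar => [|z y IH] w mr ar.
  by rewrite big1 ?mul0r// => j _; rewrite dprod_nil /= mul0r.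
have mz : multilinear_l (dtr (insr z w)) by exact: (@multilinear_l_insl _ _ z (dtr w)).
have az : alternating_l (dtr (insr z w)) by exact: (@alternating_l_insl _ _ z (dtr w)).
(* Inserting [z] into e_j^* gives the basis expansion of [w] at [z]. Inserting it into the other
   factor gives the Euler sum of [insr z w]: the sign of the antiderivation cancels that of
   exchanging [z] and e_j. *)
transitivity (\sum_j g (tnth e j) z * w [::] (tnth e j :: y) +
    \sum_j dprod (rform (g (tnth e j))) (insr (tnth e j) (insr z w)) [::] y).
  rewrite -big_split; apply: eq_bigr => j _ /=.
  rewrite dprod_consr insr_rform invr_rform dprodN.
  have -> : insr z (insr (tnth e j) w) = - insr (tnth e j) (insr z w).
    apply: dformP => x' y'.
    exact: (@alternating_l_swap _ _ (dtr w) [::] y' _ _ x').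
  rewrite linearN opprK dprod_scalel.
  by rewrite dprod1.
rewrite IH// -(multilinear_l_expansion [::] y z [::] mr).
by rewrite /= -natr1 mulrDl mul1r addrC.
Qed.

Lemma euler_l w x y : multilinear_l w -> alternating_l w ->
  \sum_j dprod (dtr (rform (g (tnth e j)))) (insl (tnth e j) w) x y =
    (size x)%:R * w x y.
Proof.
move=> ml al; rewrite -[RHS](@euler_r (dtr w) y x)//.
by apply: eq_bigr => j _; rewrite -[LHS]/(dtr (dprod _ _) y x) -dprod_tr.
Qed.

Lemma contrE w : contr e w = \sum_j insr (tnth e j) (insl (tnth e j) w).
Proof. by apply: dformP => x y; rewrite dform_sumE. Qed.

Lemma contr_linear : linear (contr e).
Proof.
move=> t a b; apply: dformP => x y; rewrite /contr -[RHS]/(t * _ + _).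
by rewrite mulr_sumr -big_split.
Qed.

HB.instance Definition _ :=
  GRing.isLinear.Build R (dform V) (dform V) *:%R (contr e) contr_linear.

Lemma has_degree_contr p q w :
  has_degree p.+1 q.+1 w -> has_degree p q (contr e w).
Proof.
move=> [hs [ml mr] [al ar]]; split.
- by move=> x y xy; rewrite /contr big1// => j _; apply: hs.
- split=> x1 x2 t u v y; rewrite /dtr /contr mulr_sumr -big_split;
    apply: eq_bigr => j _.
    exact: (ml (tnth e j :: x1)).
  exact: (mr (tnth e j :: x1) x2 t u v (tnth e j :: y)).
split=> x1 x2 u y; rewrite /dtr /contr big1// => j _.
  exact: (al (tnth e j :: x1)).
exact: (ar (tnth e j :: x1) x2 u (tnth e j :: y)).
Qed.

(** Each summand inserts e_j into both slots of the product, and the two antiderivation rules give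
    four terms: the metric times the contracted summand, g(e_j, e_j) w, and minus the two Euler
    summands. Summed over [j], the last three yield n - d - d. *)
Lemma contr_metric_commutator d w : has_degree d d w ->
  contr e (dprod G w) = dprod G (contr e w) + (n%:R - (2 * d)%:R) *: w.
Proof.
move=> [hs [ml mr] [al ar]]; apply: dformP => x y.
rewrite [contr e w]contrE linear_sum/= dformDE dform_sumE -[(_ *: w) x y]/(_ * w x y).
have -> : (n%:R - (2 * d)%:R) * w x y =
    \sum_j g (tnth e j) (tnth e j) * w x y -
    \sum_j dprod (rform (g (tnth e j))) (insr (tnth e j) w) x y -
    \sum_j dprod (dtr (rform (g (tnth e j)))) (insl (tnth e j) w) x y.
  rewrite euler_r// euler_l//.
  under eq_bigr do rewrite dot_tnth eqxx mul1r.
  rewrite sumr_const card_ord.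
  (* Euler's identity counts the lengths of [x] and [y]; these equal [d] wherever [w] is nonzero. *)
  have [|] := boolP ((size x != d) || (size y != d)).
    by move=> /hs ->; rewrite !mulr0 mul0rn !subr0.
  rewrite negb_or !negbK => /andP[/eqP -> /eqP ->].
  by rewrite natrM mulrBl -mulr_natl; ring.
rewrite -!sumrB -big_split; apply: eq_bigr => j _ /=.
rewrite dprod_consl dprod_consr (dprod_consr _ _ _ (invl G)).
rewrite insl_metric invl_metric insr_rform invr_rform.
rewrite -[insr _ (- G)]/(- insr (tnth e j) G) insr_metric.
have -> : invr (- G) = G.
  apply: etrans (opprK G); rewrite -[in RHS]invr_metric.
  by apply: dformP => x' y'; exact: mulrN.
rewrite !dprodN dprod_scalel dprod1.
rewrite -[(_ *: w) x y]/(_ * w x y).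
rewrite -[(- dprod (rform _) _) x y]/(- dprod (rform (g (tnth e j))) _ x y).
rewrite -[(- dprod (dtr _) _) x y]/(- dprod (dtr (rform (g (tnth e j)))) _ x y).
by ring.
Qed.

(** Expanding all arguments in the basis leaves values on p > n basis vectors, two of which must
    coincide. *)
Lemma has_degree_gtn p q w : has_degree p q w -> (n < p)%N -> w = 0.
Proof.
move=> [hs [ml mr] [al ar]] np; apply: dformP => x y.
have repeated x0 x1 : ~~ uniq x1 -> w (x0 ++ x1) y = 0.
  elim: x1 x0 => [//|u x1 IH] x0 /=; rewrite negb_and negbK => /orP[|nu].
    by move=> /splitPr[x2 x3]; exact: alternating_l_far.
  by rewrite -cat_rcons; exact: IH.
have [xp|xp] := eqVneq (size x) p; last by rewrite hs// xp.
(* [x1] collects the arguments already replaced by basis vectors, and [x2] those still to be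
   expanded. *)
suff in_basis x2 x1 : {subset x1 <= e} -> size (x1 ++ x2) = p -> w (x1 ++ x2) y = 0.
  exact: (in_basis x [::]).
elim: x2 x1 => [|v x2 IH] x1 x1e s1.
  rewrite cats0 in s1 *; apply: (repeated [::]); apply/negP => /uniq_leq_size.
  by move=> /(_ _ x1e); rewrite size_tuple s1 leqNgt np.
rewrite (multilinear_l_expansion x1 x2 v y ml) big1 // => j _.
rewrite -cat_rcons IH ?mulr0//.
  by move=> u; rewrite mem_rcons inE => /predU1P[->|/x1e//]; exact: mem_tnth.
by rewrite cat_rcons -s1 !size_cat.
Qed.

Lemma hformE p w r m x y : (r <= p * m)%N ->
  hform g e p w r m x y =
    (\sum_(k < r.+1) (-1) ^+ k *:
       gc_term (contr e) (dprod G) (dpow w m) (p * m)%N r k) x y.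
Proof.
set q := (p * m)%N => rq; rewrite /hform -/q dform_sumE.
(* A shift by q - r and a reversal together substitute j = q - k; the sign exponent j + q then has
   the parity of [k]. *)
rewrite -{1}[(q - r)%N]add0n big_addn subSn ?leq_subr// subKn// big_mkord.
rewrite (reindex_inj rev_ord_inj)/=.
apply: eq_bigr => k _.
have kr : (k <= r)%N by rewrite -ltnS.
rewrite /gc_term kr (leq_trans kr rq) /= subSS.
have -> : (r - k + (q - r))%N = (q - k)%N by lia.
have -> : (r + (q - k) - q)%N = (r - k)%N by lia.
have -> : (-1) ^+ (q - k + q) = (-1) ^+ k :> R.
  have -> : (q - k + q)%N = (k + (q - k).*2)%N by lia.
  by rewrite exprD -[X in _ * X]signr_odd odd_double mulr1.
rewrite dprod_dpow [divpow (contr e) _ _]/divpow divpowZ /divpow.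
rewrite !scalerA natrM invfM -[RHS]/(_ * _).
by rewrite mulrA.
Qed.

Lemma hform_eq0 p w r m x y : has_degree p p w ->
  (r <= p * m)%N -> (n < p * m + r)%N -> hform g e p w r m x y = 0.
Proof.
move=> wp rq nqr; rewrite hformE//.
rewrite (@alternating_gc_sum_eq0 _ _ _ _ (fun d => @has_degree R V d d) n)//.
- by move=> d a; exact: has_degree_contr.
- by move=> d a; exact: has_degree_dprod has_degree_metric.
- by move=> d t a; exact: has_degreeZ.
- by move=> d a; exact: has_degree_gtn.
- by move=> d a; exact: contr_metric_commutator.
exact: has_degree_dpow.
Qed.

End ContractionMetric.

(** * The vanishing ranges of h_(r, pk - pi) *)

Theorem theorem4p5 (R : realType) (V : vectType R) (g : {dot V for (@idfun R)})
    (n : nat) (hn : \dim {: V} = n)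
    (e : n.-tuple V) (e_basis : basis_of {: V} e) (e_on : orthonormal g e)
    (p : nat) (hp : (1 <= p)%N) (w : dform V) (w_deg : is_dform p p w)
    (w_sym : dsymmetric w) (w_bianchi : first_bianchi p w)
    (k i : nat) (hik : (i < k)%N) :
  [/\ forall r : nat,
        (n%:Z - (p * k)%:Z + (p * i)%:Z + 1 <= r%:Z)%R ->
        (r%:Z <= (p * k)%:Z - (p * i)%:Z)%R ->
        forall x y, hform g e p w r (k - i) x y = 0,
      n = (p * k)%N ->
        forall r : nat, (p * i + 1 <= r)%N -> (r <= n - p * i)%N ->
        forall x y, hform g e p w r (k - i) x y = 0
    & n = (p * k + 1)%N ->
        forall r : nat, (p * i + 2 <= r)%N -> (r <= n - p * i - 1)%N ->
        forall x y, hform g e p w r (k - i) x y = 0].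
Proof.
have pik : (p * i <= p * k)%N by rewrite leq_mul2l (ltnW hik) orbT.
have wp := is_dform_has_degree w_deg.
(* With m = k - i, each of the three ranges gives r <= pm and n < pm + r. *)
by split=> [r h1 h2|nE r h1 h2|nE r h1 h2] x y;
  apply: (hform_eq0 e_basis e_on) => //; rewrite mulnBr; lia.
Qed.
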